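(* Let $(\mathbb{X},\mathcal{A},\pi)$ be a probability space and let $T$ be a transition kernel on $\mathbb{X}$ (i.e. $T\colon \mathbb{X}\times\mathcal{A}\to[0,1]$ with $A\mapsto T(x,A)$ a probability measure for every $x\in\mathbb{X}$ and $x\mapsto T(x,A)$ measurable for every $A\in\mathcal{A}$) which preserves $\pi$, i.e. $\pi T=\pi$. Let $1\le p\le q$. Suppose that for all $f\in L^p(\pi)$, $$\|Tf\|_q\le \|f\|_p.$$ Then for every probability measure $\mu$ on $(\mathbb{X},\mathcal{A})$, $$\mathrm{H}(\mu T\,|\,\pi)\le \frac{p}{q}\,\mathrm{H}(\mu\,|\,\pi).$$
   Context: For a probability measure $\mu$ on $(\mathbb{X},\mathcal{A})$, $\mu T$ is the probability measure $(\mu T)(A)=\int_{\mathbb{X}} T(x,A)\,\mu(\mathrm{d}x)$. For a measurable function $f$, $Tf(x)=\int_{\mathbb{X}} f(y)\,T(x,\mathrm{d}y)$ (for signed $f$, by linearity whenever $Tf_+$ or $Tf_-$ is finite). $\|f\|_r=\left(\int |f|^r\,\mathrm{d}\pi\right)^{1/r}$. $\mathrm{H}(\mu\,|\,\pi)$ is the Kullback–Leibler divergence: $\mathrm{H}(\mu\,|\,\pi)=\int \log\left(\frac{\mathrm{d}\mu}{\mathrm{d}\pi}\right)\mathrm{d}\mu$ if $\mu\ll\pi$, and $+\infty$ otherwise. No reversibility or regularity of $T$ is assumed. *)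

(* Defs.v *)
From HB Require Import structures.
From mathcomp Require Import all_boot all_order all_algebra.
From mathcomp Require Import all_classical all_reals all_analysis.

Set Implicit Arguments.
Unset Strict Implicit.
Unset Printing Implicit Defensive.
Import Order.TTheory GRing.Theory Num.Theory.
Import numFieldNormedType.Exports.
Local Open Scope classical_set_scope.
Local Open Scope ring_scope.
Local Open Scope ereal_scope.
Local Open Scope charge_scope.

Section kpush.
Context d (X : measurableType d) (R : realType).
Variables (mu : probability X R) (T : R.-pker X ~> X).

Definition kpush_fun (A : set X) : \bar R := \int[mu]_x T x A.

Let kpush0 : kpush_fun set0 = 0.
Proof.
by rewrite /kpush_fun (eq_integral (cst 0)) ?integral0// => y _; rewrite measure0.
Qed.

Let kpush_ge0 U : 0 <= kpush_fun U. Proof. exact: integral_ge0. Qed.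

Let kpush_sigma_additive : semi_sigma_additive kpush_fun.
Proof.
move=> U mU tU mUU; rewrite [X in _ --> X](_ : _ =
  \int[mu]_y (\sum_(n <oo) T y (U n))); last first.
  apply: eq_integral => V _.
  by apply/esym/cvg_lim => //; exact/measure_semi_sigma_additive.
apply/cvg_closeP; split.
  by apply: is_cvg_nneseries => n _ _; exact: integral_ge0.
rewrite closeE// integral_nneseries// => n.
exact: (measurable_kernel T _ (mU n)).
Qed.

HB.instance Definition _ := isMeasure.Build _ _ R
  kpush_fun kpush0 kpush_ge0 kpush_sigma_additive.

Let kpush_setT : kpush_fun setT = 1.
Proof.
rewrite /kpush_fun (eq_integral (cst 1)); last by move=> x _; rewrite prob_kernel.
by rewrite integral_cst// mul1e; exact: probability_setT.
Qed.

HB.instance Definition _ :=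
  Measure_isProbability.Build _ _ R kpush_fun kpush_setT.

Definition kpush : probability X R := kpush_fun.

End kpush.

Definition kop d (X : measurableType d) (R : realType)
  (T : R.-pker X ~> X) (f : X -> R) : X -> \bar R :=
  fun x => \int[T x]_y (f y)%:E.

Definition relent d (X : measurableType d) (R : realType)
  (nu pi : probability X R) : \bar R :=
  if pselect (nu `<< pi) then
    \int[nu]_x lne (('d (charge_of_finite_measure nu) '/d pi) x)
  else +oo.

(* Main.v *)
(** Write [nu = mu T], [k = dnu/dpi], [h = dmu/dpi] and [F = k ^ (1/p)], so
    that [||F||_p = 1] and, by hypothesis, [\int (TF)^q dpi <= 1].  Since
    [ln k = p ln F], disintegrating [nu] along [T] and applying Jensen's
    inequality for [ln] in each probability [T(x, .)] gives
    [H(nu | pi) = p \int ln F dnu <= p \int ln (TF) dmu = (p/q) \int ln ((TF)^q) dmu].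
    The Gibbs variational inequality
    [\int ln G dmu <= H(mu | pi) + \int G dpi - 1], i.e. [ln t <= t - 1] at
    [t = G/h] integrated against [mu], bounds the last integral by [H(mu | pi)]
    when [G = (TF)^q]. *)

Require Import Defs.
From HB Require Import structures.
From mathcomp Require Import all_boot all_order all_algebra.
From mathcomp Require Import all_classical all_reals all_analysis.
From mathcomp Require Import measurable_realfun lra.

Set Implicit Arguments.
Unset Strict Implicit.
Unset Printing Implicit Defensive.
Import Order.TTheory GRing.Theory Num.Theory.
Local Open Scope classical_set_scope.
Local Open Scope ring_scope.

Section lne_inequalities.
Context {R : realType}.
Local Open Scope ereal_scope.

Lemma ln_le_tangent (u c : R) : (0 < u)%R -> (0 < c)%R ->
  (ln u <= ln c + u / c - 1)%R.
Proof.
move=> u0 c0.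
have h : (-1 < u / c - 1)%R by have := divr_gt0 u0 c0; lra.
have := le_ln1Dx h; rewrite addrC subrK lnM ?posrE ?invr_gt0// lnV ?posrE//.
lra.
Qed.

Lemma lne_le_tangent (s : R) (c : \bar R) : (0 < s)%R -> 0 <= c ->
  lne c <= (ln s)%:E + c * s^-1%:E - 1.
Proof.
move=> s0; case: c => [r| |] //= r0; last first.
  by rewrite gt0_mulye ?lte_fin ?invr_gt0// addey// addye.
have [r_le0|r_gt0] := leP r 0%R; first exact: leNye.
rewrite -EFinM -!EFinD lee_fin.
exact: ln_le_tangent.
Qed.

Lemma lne_poweR (c : \bar R) (r : R) : (0 < r)%R -> 0 <= c ->
  lne (c `^ r) = r%:E * lne c.
Proof.
move=> r0; case: c => [x| |] // x0; last first.
  by rewrite poweRyr ?gt_eqF//= gt0_muley ?lte_fin.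
rewrite poweR_EFin; have [->|x_neq0] := eqVneq x 0%R.
  by rewrite powR0 ?gt_eqF// !le0_lneNy// gt0_muleNy ?lte_fin.
have x_gt0 : (0 < x)%R by rewrite lt_neqAle eq_sym x_neq0 -lee_fin.
by rewrite !lne_EFin ?powR_gt0// ln_powR EFinM.
Qed.

Lemma measurable_lne : measurable_fun [set: \bar R] (@lne R).
Proof.
rewrite (_ : @lne R = fun x : \bar R => if x <= 0 then -oo else
   if x == +oo then +oo else (ln (fine x))%:E); last first.
  by apply/funext => -[x| |] //=; rewrite leNye.
apply: measurable_fun_ifT => //.
  exact: (@measurable_fun_lee _ _ _ _ id (cst 0)).
apply: measurable_fun_ifT => //.
  exact: (@measurable_fun_eqe _ _ _ _ id (cst +oo)).
by apply/measurable_EFinP; apply: measurableT_comp.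
Qed.

(* [r ln r >= -1/e], including the junk value [lne r = -oo] for [r <= 0] *)
Lemma lne_funeneg_mul_le1 (r : R) : maxe (- lne r%:E) 0 * r%:E <= 1.
Proof.
have [r_le0|r_gt0] := leP r 0%R.
  rewrite le0_lneNy ?lee_fin// /= (max_l le0y).
  have [->|r_neq0] := eqVneq r 0%R; first by rewrite mule0 lee01.
  by rewrite mulyr ltr0_sg ?lt_neqAle ?r_neq0// mulN1e leNye.
rewrite lne_EFin// -EFinN.
have [r_ge1|r_lt1] := leP 1%R r.
  by rewrite max_r ?mul0e ?lee01// lee_fin oppr_le0 ln_ge0.
rewrite max_l; last by rewrite lee_fin oppr_ge0 ln_le0// ltW.
rewrite -EFinM lee_fin.
have := ln_le_tangent ltr01 r_gt0; rewrite ln1 div1r => tangent.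
have rVr : (r * r^-1 = 1)%R by rewrite mulfV ?gt_eqF.
nra.
Qed.

Lemma ge0_muleBr (r : R) (a b : \bar R) : (0 <= r)%R -> 0 <= a -> 0 <= b ->
  r%:E * (a - b) = r%:E * a - r%:E * b.
Proof.
move=> r0 a0 b0; have [->|r_neq0] := eqVneq r 0%R; first by rewrite !mul0e sube0.
have {r_neq0} r_gt0 : (0 < r)%R by rewrite lt_neqAle eq_sym r_neq0.
case: a b a0 b0 => [a| |] [b| |] //= a0 b0.
- by rewrite -EFinB -!EFinM -EFinB mulrBr.
all: by rewrite ?gt0_muley ?gt0_muleNy ?lte_fin.
Qed.

End lne_inequalities.

Section signed_integral.
Local Open Scope ereal_scope.
Context d (T : measurableType d) (R : realType).
Variables (mu : {measure set T -> \bar R}) (D : set T) (mD : measurable D).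
Implicit Types f g : T -> \bar R.

Lemma ae_le_integral f g : measurable_fun D f -> measurable_fun D g ->
  {ae mu, forall x, D x -> f x <= g x} ->
  \int[mu]_(x in D) f x <= \int[mu]_(x in D) g x.
Proof.
move=> mf mg fg; rewrite (integralE _ _ f) (integralE _ _ g).
apply: leeB; apply: ae_ge0_le_integral => //.
- exact: measurable_funepos.
- exact: measurable_funepos.
- apply: filterS fg => x fgx Dx; rewrite !funeposE.
  by rewrite ge_max !le_max (fgx Dx) lexx !orbT.
- exact: measurable_funeneg.
- exact: measurable_funeneg.
- apply: filterS fg => x fgx Dx; rewrite !funenegE.
  by rewrite ge_max !le_max leeN2 (fgx Dx) lexx !orbT.
Qed.

Lemma integralZl_nneg (r : R) f : (0 <= r)%R -> measurable_fun D f ->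
  \int[mu]_(x in D) (r%:E * f x) = r%:E * \int[mu]_(x in D) f x.
Proof.
move=> r0 mf; rewrite integralE ge0_funeposM// ge0_funenegM//.
rewrite !ge0_integralZl_EFin//; [|exact: measurable_funeneg|exact: measurable_funepos].
by rewrite -ge0_muleBr ?integral_ge0// -integralE.
Qed.

Let adde_funeneg_subeK (a b : \bar R) : 0 <= a -> 0 <= b ->
  a + maxe (- (a - b)) 0 <= maxe (a - b) 0 + b.
Proof.
case: a b => [a| |] [b| |] //=; rewrite ?lee_fin => a0 b0.
- rewrite -!EFinB -!EFin_max -!EFinD lee_fin.
  have [ab|ab] := leP a b.
  + by rewrite (max_idPl _) ?(max_idPr _); lra.
  + by rewrite (max_idPr _) ?(max_idPl _); lra.
- by rewrite addeNy /= max_l ?leey// max_r ?leNye// add0e addey.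
- by rewrite [maxe -oo _]max_r ?leNye// adde0 addye// max_l ?leey// addye.
- by rewrite addeNy /= max_l ?leey// max_r ?leNye// add0e addey.
Qed.

Let funeneg_subeK_le (a b : \bar R) : 0 <= a -> 0 <= b ->
  maxe (- (a - b)) 0 <= b.
Proof.
move=> a0 b0; rewrite ge_max b0 andbT.
case: a b a0 b0 => [a| |] [b| |] //=; rewrite ?lee_fin => a0 b0.
- lra.
- exact: leNye.
Qed.

Lemma ge0_integralB_le f g : (forall x, D x -> 0 <= f x) ->
  (forall x, D x -> 0 <= g x) -> measurable_fun D f -> measurable_fun D g ->
  \int[mu]_(x in D) f x - \int[mu]_(x in D) g x <= \int[mu]_(x in D) (f x - g x).
Proof.
move=> f0 g0 mf mg.
have [->|/negbTE ig_neqy] := eqVneq (\int[mu]_(x in D) g x) +oo.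
  by rewrite addeNy leNye.
have ig_fin : \int[mu]_(x in D) g x \is a fin_num.
  by rewrite ge0_fin_numE ?ltey ?ig_neqy ?integral_ge0.
have mfg : measurable_fun D (f \- g) by exact: emeasurable_funB.
have [mfgp mfgn] := (measurable_funepos mfg, measurable_funeneg mfg).
have ineg_le : \int[mu]_(x in D) (f \- g)^\- x <= \int[mu]_(x in D) g x.
  apply: ge0_le_integral => // x Dx; rewrite funenegE.
  exact: funeneg_subeK_le (f0 x Dx) (g0 x Dx).
have ineg_fin : \int[mu]_(x in D) (f \- g)^\- x \is a fin_num.
  rewrite ge0_fin_numE ?integral_ge0//; apply: le_lt_trans ineg_le _.
  by rewrite ltey ig_neqy.
have le_pos : \int[mu]_(x in D) f x + \int[mu]_(x in D) (f \- g)^\- x <=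
    \int[mu]_(x in D) (f \- g)^\+ x + \int[mu]_(x in D) g x.
  rewrite -!ge0_integralD//; apply: ge0_le_integral => //.
  - by move=> x Dx; rewrite adde_ge0 ?f0.
  - exact: emeasurable_funD.
  - exact: emeasurable_funD.
  - move=> x Dx; rewrite funeposE funenegE.
    exact: adde_funeneg_subeK (f0 x Dx) (g0 x Dx).
by rewrite [leRHS]integralE leeBlDr// addeAC leeBrDr.
Qed.

End signed_integral.

Lemma Lnorm_le1_integral_poweR d (T : measurableType d) (R : realType)
    (mu : {measure set T -> \bar R}) (f : T -> \bar R) (q : R) :
  (0 < q)%R -> (forall x, (0 <= f x)%E) -> ('N[mu]_q%:E [f] <= 1)%E ->
  (\int[mu]_x f x `^ q <= 1)%E.
Proof.
move=> q_gt0 f_ge0 Nf_le1.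
rewrite (eq_integral (fun x => `|f x| `^ q)%E); last by move=> x _; rewrite gee0_abs.
rewrite -poweR_Lnorm ?gt_eqF// -(poweR1r q).
apply: gt0_ler_poweR => //; first exact: ltW.
- by rewrite in_itv/= Lnorm_ge0 leey.
- by rewrite in_itv/= lee01 leey.
Qed.

Section jensen_lne.
Local Open Scope ereal_scope.
Context d (T : measurableType d) (R : realType).
Variables (P : {measure set T -> \bar R}) (u : T -> R).
Hypotheses (P1 : P [set: T] = 1) (u_ge0 : forall x, (0 <= u x)%R)
  (mes_u : measurable_fun [set: T] u).

Let integrable_cst (r : R) : P.-integrable [set: T] (cst r%:E).
Proof.
apply/integrableP; split => //.
by rewrite integral_cst//= P1 mule1 ltry.
Qed.

Lemma jensen_lne : \int[P]_x lne (u x)%:E <= lne (\int[P]_x (u x)%:E).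
Proof.
have mlu : measurable_fun [set: T] (fun x => lne (u x)%:E).
  exact/(measurableT_comp measurable_lne)/measurable_EFinP.
have : 0 <= \int[P]_x (u x)%:E by apply: integral_ge0 => x _; rewrite lee_fin.
case cE : (\int[P]_x (u x)%:E) => [c| |] // c0; last by rewrite leey.
have intu : P.-integrable [set: T] (EFin \o u).
  apply/integrableP; split; first exact/measurable_EFinP.
  by under eq_integral => x _ do rewrite gee0_abs ?lee_fin//; rewrite cE ltry.
rewrite lee_fin le_eqVlt in c0; have [/eqP c_eq0|c_gt0] := orP c0.
  have u_ae0 : ae_eq P [set: T] (EFin \o u) (cst 0).
    apply/ae_eq_integral_abs => //; first exact/measurable_EFinP.
    by under eq_integral => x _ do rewrite gee0_abs ?lee_fin//; rewrite cE -c_eq0.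
  apply: (@le_trans _ _ (\int[P]_x (cst -oo x))).
    apply: ae_le_integral => //.
    by apply: filterS u_ae0 => x /(_ I) /= [->] _; rewrite /= lexx.
  by rewrite integral_cst//= P1 mule1 leNye.
apply: (@le_trans _ _ (\int[P]_x ((ln c - 1)%:E + (u x)%:E * c^-1%:E))).
  apply: ae_le_integral => //.
    apply: emeasurable_funD => //.
    by apply: emeasurable_funM => //; exact/measurable_EFinP.
  apply: aeW => x _; rewrite EFinB addeAC.
  by apply: lne_le_tangent; rewrite ?lee_fin.
rewrite integralD//; [|exact: integrable_cst|exact: integrableZr].
rewrite integral_cst// P1 mule1 integralZr// cE -EFinM -EFinD lne_EFin//.
by rewrite mulfV ?gt_eqF// subrK.
Qed.

End jensen_lne.

Section measurable_integral_kernel.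
Local Open Scope ereal_scope.
Context d d' (X : measurableType d) (Y : measurableType d') (R : realType).

Lemma measurable_integral_kernel (T : R.-ker X ~> Y) (f : Y -> \bar R) :
  measurable_fun [set: Y] f -> measurable_fun [set: X] (fun x => \int[T x]_y f y).
Proof.
move=> mf; under eq_fun do rewrite integralE.
have mT U : measurable U -> measurable_fun [set: X] (T ^~ U).
  exact: measurable_kernel.
by apply: emeasurable_funB; apply: measurable_fun_integral_kernel => //;
  [exact: measurable_funepos|exact: measurable_funeneg].
Qed.

End measurable_integral_kernel.

Section kpush_integral.
Local Open Scope ereal_scope.
Context d (X : measurableType d) (R : realType).
Variables (mu : probability X R) (T : R.-pker X ~> X).

Let measurable_cst_mu : measurable_fun [set: X] (cst (mu : pprobability X R)).
Proof. exact: measurable_cst. Qed.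

(* [kpush mu T] is [mkcomp] of the constant kernel [mu] with [T \o snd] *)
Lemma integral_kpush (f : X -> \bar R) : (forall x, 0 <= f x) ->
  measurable_fun [set: X] f ->
  \int[kpush mu T]_x f x = \int[mu]_y \int[T y]_x f x.
Proof.
move=> f0 mf.
rewrite (eq_measure_integral (mkcomp (kprobability measurable_cst_mu)
  (@kernel.kernel_snd _ _ _ X X X R T) point)) //.
exact: integral_kcomp.
Qed.

Lemma integral_kpush_le (f : X -> \bar R) : measurable_fun [set: X] f ->
  \int[kpush mu T]_x f x <= \int[mu]_y \int[T y]_x f x.
Proof.
move=> mf; have [mfp mfn] := (measurable_funepos mf, measurable_funeneg mf).
rewrite integralE !integral_kpush//.
under [leRHS]eq_integral do rewrite integralE.
apply: ge0_integralB_le => //; try by move=> y _; exact: integral_ge0.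
- exact: measurable_integral_kernel.
- exact: measurable_integral_kernel.
Qed.

Lemma integral_kpush_lne_le (F : X -> R) : (forall x, (0 <= F x)%R) ->
  measurable_fun [set: X] F ->
  \int[kpush mu T]_x lne (F x)%:E <= \int[mu]_y lne (kop T F y).
Proof.
move=> F0 mF.
have mlF : measurable_fun [set: X] (fun x => lne (F x)%:E).
  exact/(measurableT_comp measurable_lne)/measurable_EFinP.
apply: le_trans (integral_kpush_le mlF) _.
apply: ae_le_integral => //.
- exact: measurable_integral_kernel.
- apply: measurableT_comp measurable_lne _.
  exact/measurable_integral_kernel/measurable_EFinP.
- by apply: aeW => x _; apply: jensen_lne => //; exact: prob_kernel.
Qed.

End kpush_integral.

Lemma kpush_dominates d (X : measurableType d) (R : realType)
    (mu pi : probability X R) (T : R.-pker X ~> X) :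
  (forall A, measurable A -> kpush pi T A = pi A) ->
  mu `<< pi -> kpush mu T `<< pi.
Proof.
move=> piT mupi N piN A mA AN; have piA0 : pi A = 0%E := piN A mA AN.
have mTA : measurable_fun [set: X] (T ^~ A) := measurable_kernel T A mA.
have : (\int[pi]_x `|T x A| = 0)%E.
  rewrite -piA0 -piT//; apply: eq_integral => x _; exact: gee0_abs.
move/(ae_eq_integral_abs _ measurableT mTA)/(null_dominates_ae_eq measurableT mupi).
move=> TA_ae0; transitivity (\int[mu]_x T x A)%E => //.
by rewrite (ae_eq_integral (cst 0%E))// integral0.
Qed.

(* A real, nonnegative version of [k ^ r], [k] the density; as [0 `^ r = 0]
   for [r != 0], [r = -1] gives [1/k] where [k > 0] and [0] elsewhere. *)
Definition Radon_Nikodym_powR d (X : measurableType d) (R : realType)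
    (nu pi : probability X R) (r : R) (x : X) : R :=
  (Num.max (fine (Radon_Nikodym (charge_of_finite_measure nu) pi x)) 0) `^ r.

Lemma Radon_Nikodym_powR_ge0 d (X : measurableType d) (R : realType)
    (nu pi : probability X R) (r : R) (x : X) :
  0 <= Radon_Nikodym_powR nu pi r x.
Proof. exact: powR_ge0. Qed.

Lemma relent_Ndominates d (X : measurableType d) (R : realType)
  (nu pi : probability X R) : ~ nu `<< pi -> relent nu pi = +oo%E.
Proof. by rewrite /relent; case: pselect. Qed.

Section Radon_Nikodym_probability.
Local Open Scope ereal_scope.
Local Open Scope charge_scope.
Context d (X : measurableType d) (R : realType) (nu pi : probability X R).
Hypothesis nupi : nu `<< pi.
Local Notation k := ('d (charge_of_finite_measure nu) '/d pi).
Local Notation kpow := (Radon_Nikodym_powR nu pi).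

Let mk : measurable_fun [set: X] k. Proof. by []. Qed.

Lemma Radon_Nikodym_probability_fin_num x : k x \is a fin_num.
Proof. exact: Radon_Nikodym_fin_num. Qed.

Lemma Radon_Nikodym_probability_integral A : measurable A ->
  nu A = \int[pi]_(x in A) k x.
Proof. exact: (@Radon_Nikodym_integral _ _ _ (charge_of_finite_measure nu)). Qed.

Lemma Radon_Nikodym_ae_ge0 : {ae pi, forall x, 0 <= k x}.
Proof.
have := ae_eq_Radon_Nikodym_SigmaFinite nupi (@measurableT _ X).
apply: filterS => x /(_ I) <-.
exact: Radon_Nikodym_SigmaFinite.f_ge0.
Qed.

Lemma Radon_Nikodym_ae_gt0 : {ae nu, forall x, 0 < k x}.
Proof.
have mB : measurable [set x | k x <= 0].
  by have := emeasurable_fun_infty_c measurableT mk 0; rewrite setTI.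
exists [set x | k x <= 0]; split => //; last by move=> x /= /negP; rewrite -leNgt.
apply/eqP; rewrite eq_le measure_ge0 andbT.
rewrite Radon_Nikodym_probability_integral// integralE.
rewrite (@integral0_eq _ _ _ _ _ k^\+); last by move=> x kx_le0; rewrite funeposE max_r.
by rewrite sub0e leeNl oppe0; apply: integral_ge0 => x _; exact: funeneg_ge0.
Qed.

Lemma ge0_Radon_Nikodym_change_of_variables (f : X -> \bar R) :
  (forall x, 0 <= f x) -> measurable_fun [set: X] f ->
  \int[pi]_x (f x * k x) = \int[nu]_x f x.
Proof.
move=> f0 mf.
rewrite -(Radon_Nikodym_SigmaFinite.change_of_variables nupi f0 measurableT mf).
apply: ae_eq_integral => //.
- exact: emeasurable_funM.
- apply/emeasurable_funM/measurable_int => //.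
  exact: Radon_Nikodym_SigmaFinite.f_integrable.
- apply/ae_eqe_mul2l/ae_eq_sym.
  exact: ae_eq_Radon_Nikodym_SigmaFinite.
Qed.

Lemma measurable_Radon_Nikodym_powR r : measurable_fun [set: X] (kpow r).
Proof.
apply: measurableT_comp (measurable_powR _) _; apply: measurable_maxr => //.
exact: measurableT_comp (fine_measurable measurableT) mk.
Qed.

Lemma le_integral_mul_Radon_Nikodym_inv (G : X -> \bar R) :
  (forall x, 0 <= G x) -> measurable_fun [set: X] G ->
  \int[nu]_x (G x * (kpow (-1) x)%:E) <= \int[pi]_x G x.
Proof.
move=> G0 mG; rewrite -ge0_Radon_Nikodym_change_of_variables//; last first.
- by apply/emeasurable_funM/measurable_EFinP/measurable_Radon_Nikodym_powR.
- by move=> x; rewrite mule_ge0 ?lee_fin ?Radon_Nikodym_powR_ge0.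
apply: ae_le_integral => //.
  apply/emeasurable_funM/mk/emeasurable_funM => //.
  exact/measurable_EFinP/measurable_Radon_Nikodym_powR.
apply: aeW => x _; rewrite -muleA -(fineK (Radon_Nikodym_probability_fin_num x)).
rewrite /Radon_Nikodym_powR -EFinM; have [k_gt0|k_le0] := ltP 0%R (fine (k x)).
  by rewrite (powR_inv1 (ltW k_gt0)) mulVf ?gt_eqF// mule1.
by rewrite powR0 ?oppr_eq0 ?oner_eq0// mul0r mule0.
Qed.

Lemma Radon_Nikodym_rootK p x : (0 < p)%R ->
  (kpow p^-1 x `^ p = Num.max (fine (k x)) 0)%R.
Proof.
move=> p_gt0; rewrite -powRrM mulVf ?gt_eqF// powRr1//.
by rewrite le_max lexx orbT.
Qed.

Lemma lne_Radon_Nikodym_root p x : (0 < p)%R ->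
  lne (k x) = p%:E * lne (kpow p^-1 x)%:E.
Proof.
move=> p_gt0; rewrite -lne_poweR ?lee_fin ?Radon_Nikodym_powR_ge0//.
rewrite poweR_EFin Radon_Nikodym_rootK//.
rewrite -{1}(fineK (Radon_Nikodym_probability_fin_num x)).
have [k_gt0|k_le0] := ltP 0%R (fine (k x)) => //.
by rewrite !le0_lneNy// lee_fin.
Qed.

Lemma Lnorm_Radon_Nikodym_root p : (0 < p)%R ->
  'N[pi]_p%:E [EFin \o kpow p^-1] = 1.
Proof.
move=> p_gt0; rewrite unlock /=.
under eq_integral do
  rewrite ger0_norm ?Radon_Nikodym_powR_ge0// Radon_Nikodym_rootK//.
suff -> : \int[pi]_x (Num.max (fine (k x)) 0%R)%:E = 1 by rewrite poweR1r.
rewrite -(probability_setT nu) Radon_Nikodym_probability_integral//.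
apply: ae_eq_integral => //.
  apply/measurable_EFinP; apply: measurable_maxr => //.
  exact: measurableT_comp (fine_measurable measurableT) mk.
apply: filterS Radon_Nikodym_ae_ge0 => x k_ge0 _.
have k_fin := Radon_Nikodym_probability_fin_num x.
by rewrite max_l ?fineK// -lee_fin fineK.
Qed.

(* after the change of variables, the integrand is [(ln k)^- * k <= 1] *)
Lemma integral_funeneg_lne_Radon_Nikodym_le1 :
  \int[nu]_x (@lne R \o k)^\- x <= 1.
Proof.
have mlk : measurable_fun [set: X] (@lne R \o k).
  exact: measurableT_comp measurable_lne _.
rewrite -ge0_Radon_Nikodym_change_of_variables//; last exact: measurable_funeneg.
apply: (@le_trans _ _ (\int[pi]_x (cst 1 x))); last first.
  by rewrite integral_cst//= probability_setT mule1.
apply: ae_le_integral => //.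
  by apply: emeasurable_funM => //; exact: measurable_funeneg.
apply: aeW => x _; rewrite funenegE /= -(fineK (Radon_Nikodym_probability_fin_num x)).
exact: lne_funeneg_mul_le1.
Qed.

Lemma relentE : relent nu pi = \int[nu]_x lne (k x).
Proof. by rewrite /relent; case: pselect. Qed.

Lemma relent_gtNy : -oo < relent nu pi.
Proof.
rewrite relentE integralE; apply: (@lt_le_trans _ _ (0 - 1)); first exact: ltNyr.
apply: leeB; last exact: integral_funeneg_lne_Radon_Nikodym_le1.
by apply: integral_ge0 => x _; exact: funepos_ge0.
Qed.

Lemma integrable_lne_Radon_Nikodym : relent nu pi < +oo ->
  nu.-integrable [set: X] (@lne R \o k).
Proof.
have mlk : measurable_fun [set: X] (@lne R \o k).
  exact: measurableT_comp measurable_lne _.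
have neg_fin : \int[nu]_x (@lne R \o k)^\- x \is a fin_num.
  rewrite ge0_fin_numE; last by apply: integral_ge0 => x _; exact: funeneg_ge0.
  exact: le_lt_trans integral_funeneg_lne_Radon_Nikodym_le1 (ltry _).
rewrite relentE integralE -(fineK neg_fin) => relent_lty.
apply/integrableP; split => //.
rewrite (_ : (fun x => _) = (@lne R \o k)^\+ \+ (@lne R \o k)^\-); last first.
  exact: fune_abse.
rewrite ge0_integralD//; [|exact: measurable_funepos|exact: measurable_funeneg].
rewrite -(fineK neg_fin) lte_add_pinfty ?ltry//.
by move: relent_lty; case: (\int[nu]_x _ ^\+ x) => // r _; rewrite ltry.
Qed.

End Radon_Nikodym_probability.

Section gibbs_variational_inequality.
Local Open Scope ereal_scope.
Local Open Scope charge_scope.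
Context d (X : measurableType d) (R : realType) (mu pi : probability X R).
Variable G : X -> \bar R.
Hypotheses (G_ge0 : forall x, 0 <= G x) (mG : measurable_fun [set: X] G).

Lemma gibbs_variational_inequality :
  \int[mu]_x lne (G x) <= relent mu pi + \int[pi]_x G x - 1.
Proof.
have iG_ge0 : 0 <= \int[pi]_x G x by exact: integral_ge0.
have [->|] := eqVneq (relent mu pi + \int[pi]_x G x) +oo.
  by rewrite addye ?leey.
have [mupi|Nmupi] := pselect (mu `<< pi); last first.
  by rewrite relent_Ndominates// addye ?eqxx// gt_eqF// (lt_le_trans ltNy0 iG_ge0).
have iG_gtNy : -oo < \int[pi]_x G x := lt_le_trans ltNy0 iG_ge0.
rewrite adde_Neq_pinfty ?(gt_eqF (relent_gtNy mupi)) ?(gt_eqF iG_gtNy)//.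
move=> /andP[relent_fin iG_fin].
set h := 'd (charge_of_finite_measure mu) '/d pi.
set w := Radon_Nikodym_powR mu pi (-1).
have mGw : measurable_fun [set: X] (fun x => G x * (w x)%:E).
  by apply/emeasurable_funM/measurable_EFinP/measurable_Radon_Nikodym_powR.
have iGw : mu.-integrable [set: X] (fun x => G x * (w x)%:E).
  apply/integrableP; split => //.
  under eq_integral do
    rewrite gee0_abs ?mule_ge0 ?lee_fin ?Radon_Nikodym_powR_ge0//.
  apply: le_lt_trans (le_integral_mul_Radon_Nikodym_inv mupi G_ge0 mG) _.
  by rewrite ltey.
have ilh : mu.-integrable [set: X] (@lne R \o h).
  by apply: (integrable_lne_Radon_Nikodym mupi); rewrite ltey.
have i1 : mu.-integrable [set: X] (cst 1) by exact: finite_measure_integrable_cst.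
apply: (@le_trans _ _ (\int[mu]_x ((@lne R \o h) x + (G x * (w x)%:E - cst 1 x)))).
  apply: ae_le_integral => //.
  - exact: measurableT_comp measurable_lne mG.
  - by apply: emeasurable_funD; [exact: measurable_int ilh|exact: emeasurable_funB].
  apply: filterS (Radon_Nikodym_ae_gt0 mupi) => x hx_gt0 _.
  have hE := fineK (Radon_Nikodym_probability_fin_num mupi x).
  rewrite -/h in hx_gt0 hE; rewrite -hE lte_fin in hx_gt0.
  rewrite /= -hE lne_EFin// /w /Radon_Nikodym_powR -/h max_l ?(ltW hx_gt0)//.
  rewrite (powR_inv1 (ltW hx_gt0)) addeA.
  exact: lne_le_tangent.
rewrite integralD//; last exact: integrableB.
rewrite integralB// integral_cst//= probability_setT mule1 -(relentE mupi).
rewrite addeA EFinN leeD2r// leeD2l//.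
exact: le_integral_mul_Radon_Nikodym_inv.
Qed.

End gibbs_variational_inequality.

Section relent_kpush.
Local Open Scope ereal_scope.
Context d (X : measurableType d) (R : realType) (pi mu : probability X R).

Lemma integral_lne_le_relent (q : R) (c : X -> \bar R) : (0 < q)%R ->
  (forall x, 0 <= c x) -> measurable_fun [set: X] c ->
  \int[pi]_x c x `^ q <= 1 -> q%:E * \int[mu]_x lne (c x) <= relent mu pi.
Proof.
move=> q_gt0 c_ge0 mc cq_le1.
rewrite -integralZl_nneg ?(ltW q_gt0)//; last first.
  exact: measurableT_comp measurable_lne mc.
under eq_integral do rewrite -lne_poweR//.
apply: le_trans (gibbs_variational_inequality mu pi (fun x => poweR_ge0 _ _) _) _.
  exact: measurableT_comp (measurable_poweR _) mc.
by rewrite -addeA -[leRHS]adde0 leeD2l// leeBlDr// add0e.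
Qed.

Variable T : R.-pker X ~> X.
Hypothesis nupi : kpush mu T `<< pi.

Lemma relent_kpush_le_lne_kop (p : R) : (0 < p)%R ->
  relent (kpush mu T) pi <=
  p%:E * \int[mu]_x lne (kop T (Radon_Nikodym_powR (kpush mu T) pi p^-1) x).
Proof.
move=> p_gt0; rewrite relentE//.
under eq_integral do rewrite (lne_Radon_Nikodym_root nupi _ p_gt0).
rewrite integralZl_nneg ?(ltW p_gt0)//; last first.
  apply/(measurableT_comp measurable_lne)/measurable_EFinP.
  exact: measurable_Radon_Nikodym_powR.
apply: lee_wpmul2l; first by rewrite lee_fin ltW.
apply: integral_kpush_lne_le; first exact: Radon_Nikodym_powR_ge0.
exact: measurable_Radon_Nikodym_powR.
Qed.

End relent_kpush.

Theorem theorem2p1 (R : realType) (d : measure_display) (X : measurableType d)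
    (pi : probability X R) (T : R.-pker X ~> X) (p q : R) :
  (forall A : set X, measurable A -> kpush pi T A = pi A) ->
  1 <= p -> p <= q ->
  (forall f : X -> R, measurable_fun [set: X] f ->
     ('N[pi]_p%:E [EFin \o f] < +oo)%E ->
     ('N[pi]_q%:E [kop T f] <= 'N[pi]_p%:E [EFin \o f])%E) ->
  forall mu : probability X R,
    (relent (kpush mu T) pi <= (p / q)%:E * relent mu pi)%E.
Proof.
move=> piT p_ge1 pq hyper mu.
have p_gt0 : 0 < p by exact: lt_le_trans ltr01 p_ge1.
have q_gt0 : 0 < q by exact: lt_le_trans p_gt0 pq.
have [mupi|Nmupi] := pselect (mu `<< pi); last first.
  by rewrite (relent_Ndominates Nmupi) gt0_muley ?lte_fin ?divr_gt0// leey.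
have nupi := kpush_dominates piT mupi.
pose F := Radon_Nikodym_powR (kpush mu T) pi p^-1.
have mF : measurable_fun [set: X] F by exact: measurable_Radon_Nikodym_powR.
have TF_ge0 x : (0 <= kop T F x)%E.
  by apply: integral_ge0 => y _; rewrite lee_fin Radon_Nikodym_powR_ge0.
apply: le_trans (relent_kpush_le_lne_kop nupi p_gt0) _.
have -> : p%:E = ((p / q)%:E * q%:E)%E by rewrite -EFinM divfK ?gt_eqF.
rewrite -muleA.
apply: lee_wpmul2l; first by rewrite lee_fin ltW// divr_gt0.
apply: integral_lne_le_relent => //.
  exact/measurable_integral_kernel/measurable_EFinP.
apply: Lnorm_le1_integral_poweR => //.
by have := hyper F mF; rewrite Lnorm_Radon_Nikodym_root// => /(_ (ltry _)).
Qed.
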